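(* Let $\alpha,\beta\ge1$ with $\alpha>1$ or $\beta>1$. Then for every $t>0$ the set $\{Au_t: u_t\in\operatorname{argmin}E_t^{\alpha,\beta}(\cdot;f)\}$ is a singleton.
   Context: Setting: $\mathcal X$ is the (real) Banach space dual of a separable Banach space $\mathcal Y$; $\mathcal H$ is a real Hilbert space; $A:\mathcal X\to\mathcal H$ is bounded and linear. $J:\mathcal X\to[0,\infty]$ is convex, proper, weak$^*$ lower semi-continuous and absolutely one-homogeneous ($J(cu)=|c|J(u)$). $\mathcal N(J)=\{u:J(u)=0\}$. The datum $f\in\mathcal H$ is such that any $u\in\mathcal X$ with $Au=f$ satisfies $J(u)\ne 0$. For $\alpha,\beta\ge1$, $t>0$: $E_t^{\alpha,\beta}(u;f)=\frac1\alpha\|Au-f\|_{\mathcal H}^\alpha+\frac t\beta J(u)^\beta$ for $u\in\mathcal X$. Standing assumptions: (1) $u\mapsto\|Au\|_{\mathcal H}$ is a norm on $\mathcal N(J)$ equivalent to the restriction of $\|\cdot\|_{\mathcal X}$. (2) There is $C>0$ with $\|u-\mathcal P^A(Au)\|_{\mathcal X}\le C J(u)$ for all $u\in\mathcal X$, where $\mathcal P^A(g)$ denotes the (unique) minimizer of $\|Au-g\|_{\mathcal H}$ over $u\in\mathcal N(J)$, $g\in\mathcal H$. (3) $A$ is weak$^*$-to-weak continuous: $u_k\rightharpoonup^* u$ in $\mathcal X$ implies $Au_k\rightharpoonup Au$ in $\mathcal H$. *)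

(* Defs.v *)
From HB Require Import structures.
From mathcomp Require Import all_boot all_order all_algebra.
From mathcomp Require Import all_classical all_reals all_analysis.

Set Implicit Arguments.
Unset Strict Implicit.
Unset Printing Implicit Defensive.

Import Order.TTheory GRing.Theory Num.Theory.
Import numFieldNormedType.Exports.

Local Open Scope classical_set_scope.
Local Open Scope ring_scope.

Definition separable (T : topologicalType) : Prop :=
  exists S : set T, countable S /\ dense S.

Definition continuous_linear (R : realType) (Y : normedModType R) :
    {pred Y -> R^o} :=
  fun f => `[< linear f /\ continuous f >].

Record dual (R : realType) (Y : normedModType R) := Dual {
  dual_fun :> Y -> R^o;
  dual_funP : dual_fun \in @continuous_linear R Y }.
Arguments dual {R} Y.

Section Dual.
Context {R : realType} {Y : normedModType R}.

HB.instance Definition _ := [isSub for @dual_fun R Y].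
HB.instance Definition _ := [Choice of dual Y by <:].

Lemma continuous_linear_submod_closed :
  submod_closed (@continuous_linear R Y).
Proof.
split=> [|a f g /asboolP[lf cf] /asboolP[lg cg]]; apply/asboolP; split.
- have E z : (0 : Y -> R^o) z = 0 by [].
  by move=> c x y; rewrite !E scaler0 addr0.
- by move=> x; exact: cvg_cst.
- have E z : (a *: f + g : Y -> R^o) z = a *: f z + g z by [].
  by move=> c x y; rewrite !E lf lg !scalerDr !scalerA (mulrC a) addrACA.
- move=> x; apply: (@cvgD _ R^o); last exact: cg.
  exact: (cvgZl_tmp (cf x)).
Qed.

HB.instance Definition _ :=
  GRing.isSubmodClosed.Build R (Y -> R^o) (@continuous_linear R Y)
    continuous_linear_submod_closed.
HB.instance Definition _ := [SubChoice_isSubLmodule of dual Y by <:].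

Lemma dual_linear (u : dual Y) : linear (u : Y -> R^o).
Proof. by have /asboolP[] := dual_funP u. Qed.

Lemma dual_continuous (u : dual Y) : continuous (u : Y -> R^o).
Proof. by have /asboolP[] := dual_funP u. Qed.

HB.instance Definition _ (u : dual Y) :=
  GRing.isLinear.Build R Y R^o _ (dual_fun u) (dual_linear u).

Lemma dualP (u v : dual Y) : (forall y, u y = v y) -> u = v.
Proof. by move=> uv; apply/val_inj/funext. Qed.

Lemma dualDE (u v : dual Y) y : (u + v) y = u y + v y.
Proof. by []. Qed.

Lemma dualZE c (u : dual Y) y : (c *: u) y = c * u y.
Proof. by []. Qed.

Lemma dual0E y : (0 : dual Y) y = 0.
Proof. by []. Qed.

Definition dual_norm (u : dual Y) : R :=
  sup [set `|u y| | y in [set y : Y | `|y| <= 1]].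

Lemma dual_norm_has_sup (u : dual Y) :
  has_sup [set `|u y| | y in [set y : Y | `|y| <= 1]].
Proof.
split; first by exists `|u 0|, 0 => //=; rewrite normr0.
have [_ /(_ (dual_continuous (u := u)))] := linear_bounded_continuous u.
move=> /linear_boundedP /pinfty_ex_gt0[M M0 Mu].
exists M => _ [y /= y1 <-]; apply: (le_trans (Mu y)).
by rewrite ler_piMr // ltW.
Qed.

Lemma le_dual_norm1 (u : dual Y) y : `|y| <= 1 -> `|u y| <= dual_norm u.
Proof.
by move=> y1; apply: ub_le_sup; [case: (dual_norm_has_sup u)|exists y].
Qed.

Lemma dual_norm_le (u : dual Y) M :
  (forall y, `|y| <= 1 -> `|u y| <= M) -> dual_norm u <= M.
Proof.
move=> uM; apply: ge_sup; first by case: (dual_norm_has_sup u).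
by move=> _ [y y1 <-]; exact: uM.
Qed.

Lemma dual_normD (u v : dual Y) :
  dual_norm (u + v) <= dual_norm u + dual_norm v.
Proof.
apply: dual_norm_le => y y1; rewrite dualDE (le_trans (ler_normD _ _))//.
by rewrite lerD // le_dual_norm1.
Qed.

Lemma dual_normZ c (u : dual Y) : dual_norm (c *: u) = `|c| * dual_norm u.
Proof.
have ub a (w : dual Y) : dual_norm (a *: w) <= `|a| * dual_norm w.
  apply: dual_norm_le => y y1.
  by rewrite dualZE normrM ler_wpM2l // le_dual_norm1.
apply/eqP; rewrite eq_le ub /=.
have [->|c0] := eqVneq c 0.
  rewrite normr0 mul0r; apply: le_trans (le_dual_norm1 (y := 0) _ _) => //.
  by rewrite normr0.
rewrite -ler_pdivlMl ?normr_gt0// -normfV.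
by rewrite -[u in leLHS](scalerK c0) ub.
Qed.

Lemma dual_norm0_eq0 (u : dual Y) : dual_norm u = 0 -> u = 0.
Proof.
move=> u0; apply: dualP => y; rewrite dual0E.
have [->|y0] := eqVneq y 0; first exact: linear0.
have : `|u (`|y|^-1 *: y)| <= 0.
  by rewrite -u0 le_dual_norm1 // normrZ normfV normr_id mulVf ?normr_eq0.
rewrite normr_le0 linearZ /= => /eqP/eqP.
by rewrite scaler_eq0 invr_eq0 normr_eq0 (negbTE y0) => /eqP.
Qed.

HB.instance Definition _ := Lmodule_isNormed.Build R (dual Y)
  dual_normD dual_normZ dual_norm0_eq0.

End Dual.

Definition weak_star (R : realType) (Y : normedModType R) : Type :=
  initial_topology (fun u : dual Y => (u : {ptws Y -> R^o})).

HB.instance Definition _ (R : realType) (Y : normedModType R) :=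
  Topological.on (@weak_star R Y).

(* The weak topology is the one induced by the evaluations phi x, phi : dual V,
   just as weak_star is the one induced by the evaluations u y, y : Y. *)
Definition weak (R : realType) (V : normedModType R) : Type :=
  initial_topology (fun x : V => (fun phi => phi x) : {ptws dual V -> R^o}).

HB.instance Definition _ (R : realType) (V : normedModType R) :=
  Topological.on (@weak R V).

Arguments weak_star {R} Y.
Arguments weak {R} V.

Definition weak_star_cvg (R : realType) (Y : normedModType R)
    (u_ : nat -> dual Y) (u : dual Y) : Prop :=
  (u_ k : weak_star Y) @[k --> \oo] --> (u : weak_star Y).

Definition weak_cvg (R : realType) (V : normedModType R)
    (x_ : nat -> V) (x : V) : Prop :=
  (x_ k : weak V) @[k --> \oo] --> (x : weak V).

Lemma weak_star_cvgP (R : realType) (Y : normedModType R)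
    (u_ : nat -> dual Y) (u : dual Y) :
  weak_star_cvg u_ u <->
  forall y, (u_ k y : R^o) @[k --> \oo] --> (u y : R^o).
Proof.
pose i (v : dual Y) : {ptws Y -> R^o} := v.
split=> [cu y|cu].
  have /pointwise_cvgP := cvg_comp _ _ cu (@initial_continuous _ _ i u).
  exact.
have iu : i \o u_ @ \oo --> i u by apply/pointwise_cvgP.
move=> B [C [[D oD <-] Du DB]].
have [n _ nD] := iu D (open_nbhs_nbhs (conj oD Du)).
by exists n => // k /= nk; apply: DB; exact: nD.
Qed.

Lemma weak_cvgP (R : realType) (V : normedModType R)
    (x_ : nat -> V) (x : V) :
  weak_cvg x_ x <->
  forall phi : dual V, (phi (x_ k) : R^o) @[k --> \oo] --> (phi x : R^o).
Proof.
pose i (z : V) : {ptws dual V -> R^o} := fun phi => phi z.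
split=> [cx phi|cx].
  have /pointwise_cvgP := cvg_comp _ _ cx (@initial_continuous _ _ i x).
  exact.
have ix : i \o x_ @ \oo --> i x by apply/pointwise_cvgP.
move=> B [C [[D oD <-] Dx DB]].
have [n _ nD] := ix D (open_nbhs_nbhs (conj oD Dx)).
by exists n => // k /= nk; apply: DB; exact: nD.
Qed.

HB.mixin Record isHilbert (R : realType) H of CompleteNormedModule R H := {
  inner : H -> H -> R;
  innerC : forall x y, inner x y = inner y x;
  inner_linearl : forall c x y z,
    inner (c *: x + y) z = c * inner x z + inner y z;
  inner_norm : forall x, inner x x = `|x| ^+ 2 }.

#[short(type="hilbertType")]
HB.structure Definition Hilbert (R : realType) :=
  {H of isHilbert R H & CompleteNormedModule R H}.

Definition argmin_on (T : Type) (d : Order.disp_t) (V : porderType d)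
    (D : set T) (F : T -> V) : set T :=
  [set u | D u /\ forall v, D v -> (F u <= F v)%O].

Section Functionals.
Context {R : realType}.

Definition econvex (V : lmodType R) (J : V -> \bar R) : Prop :=
  forall (a : R) (u v : V), 0 <= a <= 1 ->
    (J (a *: u + (1 - a) *: v)%R <= a%:E * J u + (1 - a)%:E * J v)%E.

(* For c = 0 and J u = +oo the right-hand side is 0 * +oo = 0. *)
Definition abs_one_homogeneous (V : lmodType R) (J : V -> \bar R) : Prop :=
  forall (c : R) (u : V), J (c *: u) = (`|c|%:E * J u)%E.

Definition nullspace (V : Type) (J : V -> \bar R) : set V :=
  [set u | J u = 0%E].

Definition norm_on (V : lmodType R) (N : set V) (p : V -> R) : Prop :=
  [/\ forall u v, N u -> N v -> p (u + v) <= p u + p v,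
      forall c u, N u -> p (c *: u) = `|c| * p u &
      forall u, N u -> p u = 0 -> u = 0].

Definition equivalent_on (V : Type) (N : set V) (p q : V -> R) : Prop :=
  exists c C, [/\ 0 < c, 0 < C & forall u, N u -> c * q u <= p u <= C * q u].

(* A minimizer exists and is unique under the standing assumptions (the norms
   ||A u|| and ||u|| are equivalent on the weak-star closed space nullspace J),
   so the default value 0 of xget is then irrelevant. *)
Definition null_proj (V H : normedModType R) (A : V -> H) (J : V -> \bar R)
    (g : H) : V :=
  xget 0 (argmin_on (nullspace J) (fun u => `|A u - g|)).

Definition energy (V H : normedModType R) (A : V -> H) (J : V -> \bar R)
    (alpha beta t : R) (f : H) (u : V) : \bar R :=
  ((alpha^-1 * `|A u - f| `^ alpha)%:E + (t / beta)%:E * J u `^ beta)%E.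

End Functionals.

(* Main.v *)
Require Import Defs.
From mathcomp Require Import all_boot all_order all_algebra.
From mathcomp Require Import all_classical all_reals all_analysis.
From mathcomp Require Import ring lra.
From HB Require Import structures.

(** The set of values [A u] is nonempty because a minimizer exists, and it has
    at most one element because two minimizers with different images would have
    a midpoint of smaller energy.

    Existence is the direct method ([energy_argmin_exists]).  Along a minimizing
    sequence both [J u_k] and [|A u_k|] stay bounded.  Split [u_k] into its
    projection on the null space of [J] and the remainder: the projection is
    controlled by [|A u_k|], since [|A .|] is equivalent to the norm there, and
    the remainder by [J u_k], by the Poincare inequality ([norm_coercive]).
    Hence [u_k] is bounded and, [Y] being separable, has a weak-star convergent
    subsequence ([weak_star_sequentially_compact]).  Both terms of the energy
    are lower semicontinuous along it, [J] by assumption and the fidelity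
    because [A] maps it to a weakly convergent sequence and the norm of a
    Hilbert space is weakly lower semicontinuous ([weak_cvg_norm_lsc]).

    For uniqueness ([energy_argmin_unique]) compare two minimizers [u], [v] with
    their midpoint.  By convexity of the norm, of [J] and of the powers, the
    energy of the midpoint is at most the common minimum, so none of these
    inequalities may be strict.  If [alpha > 1], strict convexity of the power
    forces [|A u - f| = |A v - f|].  If [beta > 1], it forces [J u = J v], and
    equality of the energies again gives [|A u - f| = |A v - f|].  Two distinct
    vectors of equal norm in a Hilbert space have a strictly shorter midpoint
    ([norm_midpoint_lt]), so [A u = A v]. *)

Import Order.TTheory GRing.Theory Num.Theory.
Import numFieldNormedType.Exports.

Local Open Scope classical_set_scope.
Local Open Scope ring_scope.

(** * Inequalities for real powers *)

(** Strict Bernoulli inequality: the power function lies strictly above its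
    tangent at 1.  For [x > 0], write [x `^ p = x * expR ((p - 1) * ln x)] and
    use [1 + y <= expR y] twice, the second time in the strict form
    [1 - x^-1 < ln x]. *)
Lemma powR_gt_tangent1 {R : realType} (p x : R) :
  1 < p -> 0 <= x -> x != 1 -> 1 + p * (x - 1) < x `^ p.
Proof.
move=> p1; rewrite le0r => /orP[/eqP -> _|x0 x1].
  by rewrite powR0 ?gt_eqF//; lra.
have lnx : 1 - x^-1 < ln x.
  have : - ln x != 0 by rewrite oppr_eq0 ln_eq0.
  by move=> /expR_gt1Dx; rewrite expRN lnK//; lra.
have -> : x `^ p = x * x `^ (p - 1).
  rewrite -[X in X * _]powRr1 ?(ltW x0)// -powRD ?(gt_eqF x0) ?implybT//.
  by congr (_ `^ _); lra.
have xp : 1 + (p - 1) * ln x <= x `^ (p - 1).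
  by rewrite /powR gt_eqF// expR_ge1Dx.
have : x * (1 + (p - 1) * (1 - x^-1)) < x * x `^ (p - 1).
  rewrite ltr_pM2l// (lt_le_trans _ xp)// ltrD2l ltr_pM2l//; lra.
have -> : x * (1 + (p - 1) * (1 - x^-1)) = 1 + p * (x - 1).
  by field; rewrite gt_eqF.
by [].
Qed.

(** Rescaling by the midpoint [c] moves the tangent of Bernoulli's inequality
    to [c]; in the sum of the two tangent bounds the linear terms cancel. *)
Lemma powR_midpoint_lt {R : realType} (p a b : R) :
  1 < p -> 0 <= a -> 0 <= b -> a != b ->
  (2^-1 * (a + b)) `^ p < 2^-1 * (a `^ p + b `^ p).
Proof.
move=> p1 a0 b0 ab.
set c := 2^-1 * (a + b).
have c0 : 0 < c.
  rewrite /c mulr_gt0//; rewrite lt_neqAle addr_ge0// andbT eq_sym.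
  rewrite paddr_eq0//; apply: contra ab => /andP[/eqP-> /eqP->]; exact: eqxx.
have scale z : 0 <= z -> z != c ->
    c `^ p * (1 + p * (z / c - 1)) < z `^ p.
  move=> z0 zc.
  have -> : z `^ p = c `^ p * (z / c) `^ p.
    by rewrite -powRM ?(ltW c0) ?divr_ge0 ?(ltW c0)// mulrC divfK// gt_eqF.
  rewrite ltr_pM2l ?powR_gt0//; apply: powR_gt_tangent1 => //.
    by rewrite divr_ge0// ltW.
  by apply: contra zc => /eqP z1; rewrite -[z](divfK (lt0r_neq0 c0)) z1 mul1r.
have := scale _ a0; have := scale _ b0.
have -> : b != c by apply: contra ab; rewrite /c => /eqP h; apply/eqP; lra.
have -> : a != c by apply: contra ab; rewrite /c => /eqP h; apply/eqP; lra.
move=> /(_ isT) hb /(_ isT) ha.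
have e : c `^ p * (1 + p * (a / c - 1)) + c `^ p * (1 + p * (b / c - 1)) = 2 * c `^ p.
  have h : a / c + b / c = 2.
    by rewrite -mulrDl (_ : a + b = 2 * c) ?mulfK ?gt_eqF// /c; lra.
  rewrite -mulrDr [LHS](_ : _ = c `^ p * (2 + p * (a / c + b / c - 2))); last by ring.
  by rewrite h; ring.
lra.
Qed.

Lemma powR_midpoint_le {R : realType} (p a b : R) :
  1 <= p -> 0 <= a -> 0 <= b ->
  (2^-1 * (a + b)) `^ p <= 2^-1 * (a `^ p + b `^ p).
Proof.
rewrite le_eqVlt => /orP[/eqP <- a0 b0|p1 a0 b0].
  by rewrite !powRr1// mulr_ge0 ?addr_ge0.
have [<-|ab] := eqVneq a b; last by rewrite ltW// powR_midpoint_lt.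
have half z : 2^-1 * (z + z) = z :> R by lra.
by rewrite !half.
Qed.

(** Turns bounds on the two terms of the energy into bounds on [|A u - f|] and
    [J u] that do not mention roots. *)
Lemma le_powR1D {R : realType} (p x : R) : 1 <= p -> x <= 1 + x `^ p.
Proof.
move=> p1; have [x1|x1] := leP x 1; first by rewrite ler_wpDr// powR_ge0.
have x0 : 0 <= x by lra.
rewrite ler_wpDl// -{1}[x]powRr1//; apply: ler_powR => //; exact: ltW.
Qed.

(** A form of lower semicontinuity tailored to the two terms of the energy: the
    assumption on [x_] says that [x] is at most the lower limit of [x_], and the
    powers of [x_] converge.  The value [+oo] of [x] is excluded by the
    conclusion, which gives [J u < +oo] for the weak-star limit [u]. *)
Lemma poweR_le_cvg {R : realType} (p l : R) (x : \bar R) (x_ : nat -> R) :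
  0 < p -> (0 <= x)%E ->
  (forall c : R, (c%:E < x)%E -> \forall k \near \oo, c < x_ k) ->
  x_ k `^ p @[k --> \oo] --> l -> (x `^ p <= l%:E)%E.
Proof.
move=> p0 x0 x_lsc x_l; rewrite leNgt; apply/negP => l_lt.
have l0 : 0 <= l.
  by apply: (cvgr_to_ge x_l); apply: nearW => k; exact: powR_ge0.
(* A level strictly between [l] and [x `^ p], pulled back through the power. *)
have [r lr rx] : exists2 r, l < r & ((r `^ p^-1)%:E < x)%E.
  move: x x0 l_lt {x_lsc} => [y| |]// y0 l_lt; last first.
    by exists (l + 1); rewrite ?ltry// ltrDl.
  rewrite poweR_EFin lte_fin in l_lt.
  exists (2^-1 * (l + y `^ p)); first by lra.
  rewrite lte_fin; rewrite lee_fin in y0.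
  rewrite -[ltRHS](powRr1 y0) -[X in _ < _ `^ X](mulfV (lt0r_neq0 p0)) powRrM.
  rewrite gt0_ltr_powR ?invr_gt0 ?nnegrE ?powR_ge0//; last by lra.
  by rewrite mulr_ge0// addr_ge0// powR_ge0.
have r0 : 0 <= r by rewrite (le_trans l0)// ltW.
suff : r <= l by rewrite leNgt lr.
apply: (cvgr_to_ge x_l).
apply: filterS (x_lsc _ rx) => k rk.
rewrite -[leLHS](powRr1 r0) -[X in _ `^ X <= _](mulVf (lt0r_neq0 p0)) powRrM.
by rewrite ltW// gt0_ltr_powR ?nnegrE ?powR_ge0// (le_trans (powR_ge0 _ _) (ltW rk)).
Qed.

(** * Inner products: Cauchy-Schwarz, midpoints, weak lower semicontinuity *)

Section inner.
Context {R : realType} {H : hilbertType R}.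
Implicit Types x y z : H.

Lemma innerDl x y z : inner (x + y) z = inner x z + inner y z.
Proof. by rewrite -{1}[x]scale1r inner_linearl mul1r. Qed.

Lemma inner0l z : inner 0 z = 0.
Proof. by apply: (addrI (inner 0 z)); rewrite -innerDl !addr0. Qed.

Lemma innerZl c x z : inner (c *: x) z = c * inner x z.
Proof. by rewrite -[c *: x]addr0 inner_linearl inner0l addr0. Qed.

Lemma innerDr x y z : inner z (x + y) = inner z x + inner z y.
Proof. by rewrite innerC innerDl !(innerC _ z). Qed.

Lemma innerZr c x z : inner z (c *: x) = c * inner z x.
Proof. by rewrite innerC innerZl innerC. Qed.

Lemma norm_combination2 (a b : R) x y :
  `|a *: x + b *: y| ^+ 2 =
  a ^+ 2 * `|x| ^+ 2 + 2 * a * b * inner x y + b ^+ 2 * `|y| ^+ 2.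
Proof.
rewrite -!inner_norm innerDl !innerDr !innerZl !innerZr (innerC y x); ring.
Qed.

(** Expand the square norm of [|y| x - |x| y]. *)
Lemma inner_le_norm x y : inner x y <= `|x| * `|y|.
Proof.
have [->|x0] := eqVneq x 0; first by rewrite inner0l normr0 mul0r.
have [->|y0] := eqVneq y 0; first by rewrite innerC inner0l normr0 mulr0.
have := sqr_ge0 (`| `|y| *: x + (- `|x|) *: y |).
rewrite norm_combination2.
have -> : `|y| ^+ 2 * `|x| ^+ 2 + 2 * `|y| * - `|x| * inner x y +
   (- `|x|) ^+ 2 * `|y| ^+ 2 = (2 * (`|x| * `|y|)) * (`|x| * `|y| - inner x y).
  by ring.
by rewrite pmulr_rge0 ?subr_ge0// !mulr_gt0// normr_gt0.
Qed.

Lemma inner_norm_le x y : `|inner x y| <= `|x| * `|y|.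
Proof.
rewrite ler_norml inner_le_norm andbT lerNl.
by have := inner_le_norm (-1 *: x) y; rewrite innerZl mulN1r normrZ normrN1 mul1r.
Qed.

(** The parallelogram identity. *)
Lemma norm_midpoint2 x y :
  `|2^-1 *: (x + y)| ^+ 2 =
  2^-1 * (`|x| ^+ 2 + `|y| ^+ 2) - (2^-1 * `|x - y|) ^+ 2.
Proof.
have -> : x - y = 1 *: x + (-1) *: y by rewrite scale1r scaleN1r.
by rewrite scalerDr exprMn !norm_combination2; field.
Qed.

Lemma norm_midpoint_lt x y :
  `|x| = `|y| -> x != y -> `|2^-1 *: (x + y)| < `|x|.
Proof.
move=> xy neq; rewrite -(@ltr_pXn2r _ 2)//; rewrite ?nnegrE//.
rewrite norm_midpoint2 -xy.
have : 0 < (2^-1 * `|x - y|) ^+ 2.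
  by rewrite exprn_gt0// mulr_gt0// normr_gt0 subr_eq0.
by lra.
Qed.

(** Makes the pairing with a fixed vector a test functional for weak convergence. *)
Lemma inner_continuous_linear z :
  (fun x => inner x z : R^o) \in @continuous_linear R H.
Proof.
have lin : linear (fun x => inner x z : R^o) by move=> a x y; rewrite inner_linearl.
pose F := GRing.isLinear.Build R H R^o _ _ lin.
pose L : {linear H -> R^o} := HB.pack (fun x => inner x z : R^o) F.
apply/asboolP; split => //.
apply: (@bounded_linear_continuous _ _ _ L).
apply/linear_boundedP.
apply: filterS (nbhs_pinfty_ge (num_real `|z|)) => M zM x.
by rewrite (le_trans (inner_norm_le x z))// mulrC ler_wpM2r.
Qed.

(** Test weak convergence against the limit [x] itself: [inner (x_ k) x] tends to
    [|x| ^ 2] and is at most [|x_ k| |x|]. *)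
Lemma weak_cvg_norm_lsc (x_ : nat -> H) x c :
  weak_cvg x_ x -> c < `|x| -> \forall k \near \oo, c < `|x_ k|.
Proof.
move=> cx cltx.
have [c0|c0] := ltP c 0; first by near=> k; exact: (lt_le_trans c0).
have x0 : 0 < `|x| by exact: le_lt_trans cltx.
have /weak_cvgP /(_ (Dual (inner_continuous_linear x))) /= := cx.
move=> /cvgr_gt /(_ (c * `|x|)).
rewrite inner_norm expr2 ltr_pM2r// => /(_ cltx) H1.
near=> k; rewrite -(ltr_pM2r x0).
apply: lt_le_trans (inner_le_norm _ _).
by near: k.
Unshelve. all: by end_near. Qed.

End inner.

Lemma weak_cvgB_cst {R : realType} {V : normedModType R} (x_ : nat -> V) (x z : V) :
  weak_cvg x_ x -> weak_cvg (fun k => x_ k - z) (x - z).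
Proof.
move=> /weak_cvgP cx; apply/weak_cvgP => phi.
rewrite linearB /=.
have -> : (fun k => phi (x_ k - z)) = (fun k => (phi (x_ k) : R^o) - phi z).
  by apply/funext => k; rewrite linearB.
by apply: (@cvgB _ R^o); [exact: cx | exact: cvg_cst].
Qed.

(** * Sequential weak-star compactness *)

Lemma dual_norm_bound {R : realType} {Y : normedModType R} (u : dual Y) y :
  `|u y| <= `|u| * `|y|.
Proof.
have [->|y0] := eqVneq y 0; first by rewrite linear0 !normr0 mulr0.
have y_gt0 : 0 < `|y| by rewrite normr_gt0.
rewrite -ler_pdivrMr//.
have : `|u (`|y|^-1 *: y)| <= dual_norm u.
  by rewrite le_dual_norm1 // normrZ normfV normr_id mulVf ?normr_eq0.
by rewrite linearZ /= normrM normfV normr_id mulrC.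
Qed.

(** If [G] refines the image of [U] and contains [B], then [g @^-1` B] belongs
    to [U], for otherwise its complement does and [G] contains [B] and its
    complement. *)
Lemma ultrafilter_image {T S : Type} (g : T -> S) (U : set_system T) :
  UltraFilter U -> UltraFilter (g @ U).
Proof.
move=> UU; have PU : ProperFilter U by exact: ultra_proper.
split=> [|G PG UG]; first exact: fmap_proper_filter.
apply/seteqP; split; last exact: UG.
move=> B GB; have [//|nB] := in_ultra_setVsetC (g @^-1` B) UU.
exfalso; apply: (@filter_not_empty _ G).
by rewrite -(setICr B); apply: filterI => //; exact: UG.
Qed.

Lemma countable_dense_seq {R : realType} {Y : normedModType R} :
  separable Y -> exists s : nat -> Y,
    forall y (d : R), 0 < d -> exists i, `|y - s i| < d.
Proof.
move=> [S [cS dS]].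
have [S0|/surjfunPex[s sS]] := pfcard_geP cS.
  have [y [_]] := dS setT (ex_intro _ 0 I) openT.
  by rewrite S0.
exists s => y d d0.
have bo : open (ball y d) by exact: ball_open.
have [z [yz Sz]] := dS (ball y d) (ex_intro _ y (ballxx y d0)) bo.
move: Sz; rewrite sS => -[i _ iz].
exists i; rewrite iz; by move: yz; rewrite -ball_normE.
Qed.

(** Sequential Banach-Alaoglu theorem.  An ultrafilter refining [\oo] makes all
    the bounded scalar sequences [u_ k y] converge at once, and the limits form
    a bounded linear functional.  Since every set of the ultrafilter is
    nonempty, an index [phi n >= n] can be chosen for which [u_ (phi n)] is
    close to the limit at the first [n + 1] points of a dense sequence; the
    uniform bound on the norms extends the convergence to every point, so that
    no diagonal extraction takes place. *)
Lemma weak_star_sequentially_compact {R : realType} {Y : normedModType R}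
    (u_ : nat -> dual Y) (M : R) :
  separable Y -> (forall k, `|u_ k| <= M) ->
  exists (phi : nat -> nat) (u : dual Y),
    (forall n, (n <= phi n)%N) /\ weak_star_cvg (u_ \o phi) u.
Proof.
move=> /countable_dense_seq[s s_dense] uM.
have M0 : 0 <= M by exact: le_trans (uM 0%N).
have uyM k y : `|u_ k y| <= M * `|y|.
  by rewrite (le_trans (dual_norm_bound _ _))// ler_wpM2r.
have [U [UU oU]] := @ultraFilterLemma nat \oo _.
have PU : ProperFilter U by exact: ultra_proper.
have /choice[L LP] y : exists l : R^o,
    `|l| <= M * `|y| /\ u_ k y @[k --> U] --> l.
  have : compact `[- (M * `|y|), M * `|y|] := @segment_compact R _ _.
  rewrite compact_ultra => /(_ ((fun k => u_ k y : R) @ U)).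
  case.
  - exact: ultrafilter_image.
  - by apply: nearW => k /=; rewrite in_itv /= -ler_norml.
  by move=> l [/=]; rewrite in_itv /= -ler_norml => lM ul; exists l.
have Llin : linear (L : Y -> R^o).
  move=> a x y; apply: (cvg_unique (@norm_hausdorff R R^o) (LP _).2).
  have -> : (fun k => u_ k (a *: x + y)) = (fun k => a *: (u_ k x : R^o) + u_ k y).
    by apply/funext => k; rewrite linearP.
  apply: (@cvgD _ R^o); last exact: (LP y).2.
  exact: (cvgZl_tmp (LP x).2).
pose Llinear : {linear Y -> R^o} :=
  HB.pack L (GRing.isLinear.Build R Y R^o _ L Llin).
have Lcl : (L : Y -> R^o) \in @continuous_linear R Y.
  apply/asboolP; split => //.
  apply: (@bounded_linear_continuous _ _ _ Llinear).
  apply/linear_boundedP.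
  apply: filterS (nbhs_pinfty_ge (num_real M)) => r Mr x.
  by apply: (le_trans (LP x).1); rewrite ler_wpM2r.
have /choice[phi phiP] n : exists k, (n <= k)%N /\
    forall i : 'I_n.+1, `|L (s i) - u_ k (s i)| < n.+1%:R^-1.
  apply: (@filter_ex _ U).
  apply: filterI; first by apply: oU; exact: nbhs_infty_ge.
  apply: filter_forall => i.
  by have /cvgrPdist_lt/(_ n.+1%:R^-1) := (LP (s i)).2; apply; rewrite invr_gt0.
exists phi, (Dual Lcl); split; first by move=> n; exact: (phiP n).1.
apply/weak_star_cvgP => y /=; apply/cvgrPdist_lt => e e0.
have M1 : 0 < M + 1 by rewrite ltr_wpDl.
(* An [M]-Lipschitz functional varies by at most [e / 4] over a distance [d];
   the [+ 1] covers the case [M = 0]. *)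
pose d := e / (4 * (M + 1)).
have d0 : 0 < d by rewrite divr_gt0// mulr_gt0.
have [i yi] := s_dense y d d0.
have e2 : 0 < e / 2 by rewrite divr_gt0.
have Md : M * d <= e / 4.
  have -> : e / 4 = (M + 1) * d.
    by rewrite /d; field; rewrite gt_eqF.
  by rewrite ler_wpM2r ?(ltW d0)// lerDl.
near=> n.
have ni : (i < n.+1)%N by near: n; exact: nbhs_infty_ge.
have ne : n.+1%:R^-1 < e / 2.
  by near: n; exact: (near_infty_natSinv_lt (PosNum e2)).
have h1 : `|L y - L (s i)| <= e / 4.
  have -> : L y - L (s i) = Llinear (y - s i) by rewrite linearB.
  apply: le_trans (LP _).1 _; apply: le_trans Md.
  by rewrite ler_wpM2l// ltW.
have h2 := lt_trans ((phiP n).2 (Ordinal ni)) ne.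
have h3 : `|u_ (phi n) (s i) - u_ (phi n) y| <= e / 4.
  rewrite -linearB; apply: le_trans (uyM _ _) _; apply: le_trans Md.
  by rewrite ler_wpM2l// distrC ltW.
have -> : L y - u_ (phi n) y = (L y - L (s i)) +
  ((L (s i) - u_ (phi n) (s i)) + (u_ (phi n) (s i) - u_ (phi n) y)).
  by rewrite !addrA !subrK.
rewrite (le_lt_trans (ler_normD _ _))//.
rewrite (le_lt_trans (lerD (lexx _) (ler_normD _ _)))//.
move: h1 h2 h3 => /=; lra.
Unshelve. all: by end_near. Qed.

(** * Coercivity and finiteness of the energy *)

Section coercivity.
Context {R : realType} {V H : normedModType R}.
Context (A : {linear V -> H}) (J : V -> \bar R).

(** A minimizer of the residual on the null space does at least as well as the
    element 0 of that space, and 0 is also the default value of [null_proj]; so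
    the bound holds whether or not a minimizer exists. *)
Lemma null_proj_bound (g : H) :
  J 0 = 0%E ->
  J (null_proj A J g) = 0%E /\ `|A (null_proj A J g)| <= 2 * `|g|.
Proof.
move=> J0; rewrite /null_proj; case: xgetP => [v _ [vN vmin]|_]; last first.
  by rewrite linear0 normr0 mulr_ge0.
split; first exact: vN.
have := vmin 0 J0; rewrite linear0 sub0r normrN => vg.
rewrite -[A v](subrK g) (le_trans (ler_normD _ _))// mulrDl !mul1r; lra.
Qed.

(** Triangle inequality for the splitting of [u] into its projection on the null
    space, measured by [|A .|], and the remainder, measured by [J]. *)
Lemma norm_coercive (C : R) :
  0 <= C -> J 0 = 0%E -> (forall u, (0 <= J u)%E) ->
  equivalent_on (nullspace J) (fun u => `|A u|) (fun u => `|u|) ->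
  (forall u, (`|u - null_proj A J (A u)|%:E <= C%:E * J u)%E) ->
  exists2 D : R, 0 <= D & forall u, J u \is a fin_num ->
    `|u| <= C * fine (J u) + D * `|A u|.
Proof.
move=> C0 J0 Jge0 [c [c' [c0 _ Nequiv]]] Jp.
exists (2 / c) => [|u Ju]; first by rewrite divr_ge0// ltW.
have [PN PA] := null_proj_bound (A u) J0.
have := Jp u; rewrite -[in X in X -> _](fineK Ju) -EFinM lee_fin => Jpu.
have := Nequiv _ PN => /andP[+ _].
move=> /le_trans/(_ PA); rewrite mulrC -ler_pdivlMr// mulrAC => Pu.
rewrite -[u in leLHS](subrK (null_proj A J (A u))).
by rewrite (le_trans (ler_normD _ _))// lerD.
Qed.

End coercivity.

Section energy_finite.
Context {R : realType} {V H : normedModType R}.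
Context (A : V -> H) (J : V -> \bar R) (alpha beta t : R) (f : H).

Lemma energy_fin (u : V) : J u \is a fin_num ->
  energy A J alpha beta t f u =
  (alpha^-1 * `|A u - f| `^ alpha + t / beta * fine (J u) `^ beta)%:E.
Proof. by move=> Ju; rewrite /energy -{1}(fineK Ju). Qed.

Lemma energy_fin_num (u : V) : 0 < beta -> 0 < t -> (0 <= J u)%E ->
  (energy A J alpha beta t f u < +oo)%E -> J u \is a fin_num.
Proof.
move=> b0 t0; rewrite /energy; case: (J u) => // _.
by rewrite poweRyr ?gt_eqF// gt0_muley ?lte_fin ?divr_gt0.
Qed.

Lemma energy_ge0 (u : V) : 0 < alpha -> 0 < beta -> 0 < t ->
  (0 <= energy A J alpha beta t f u)%E.
Proof.
move=> a0 b0 t0; rewrite adde_ge0//.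
  by rewrite lee_fin mulr_ge0 ?powR_ge0// invr_ge0 ltW.
by rewrite mule_ge0 ?poweR_ge0// lee_fin ltW// divr_gt0.
Qed.

End energy_finite.

(** * Existence of a minimizer *)

(** Composing with such a [phi] preserves limits at infinity although [phi] may
    fail to be monotone. *)
Lemma cvg_infty_ge (phi : nat -> nat) :
  (forall n, (n <= phi n)%N) -> phi n @[n --> \oo] --> \oo.
Proof.
move=> phiP B [N _ NB]; exists N => // n /= Nn.
by apply: NB; exact: leq_trans (phiP n).
Qed.

(** The direct method.  A subsequence along which the fidelity terms converge
    suffices: the regularization terms then converge as well, because the
    energies do, and the two limits add up to the infimum. *)
Lemma energy_argmin_exists {R : realType} {Y : normedModType R}
  (Y_separable : separable Y) {H : hilbertType R}
  (A : {linear dual Y -> H}) (J : dual Y -> \bar R)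
  (J_ge0 : forall u, (0 <= J u)%E) (J0 : J 0 = 0%E)
  (J_lsc : lower_semicontinuous (J : weak_star Y -> \bar R))
  (coercive : exists C D : R, [/\ 0 <= C, 0 <= D & forall u,
     J u \is a fin_num -> `|u| <= C * fine (J u) + D * `|A u|])
  (A_weak : forall (u_ : nat -> dual Y) (u : dual Y),
    weak_star_cvg u_ u -> weak_cvg (fun k => A (u_ k)) (A u))
  (f : H) (alpha beta t : R) (alpha_ge1 : 1 <= alpha) (beta_ge1 : 1 <= beta)
  (t_gt0 : 0 < t) :
  exists u, argmin_on setT (energy A J alpha beta t f) u.
Proof.
have alpha_gt0 : 0 < alpha by exact: lt_le_trans alpha_ge1.
have beta_gt0 : 0 < beta by exact: lt_le_trans beta_ge1.
set E := energy A J alpha beta t f.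
have E_ge0 u : (0 <= E u)%E by exact: energy_ge0.
pose S := [set e : R | exists u, E u = e%:E].
have S_inf : has_inf S.
  split; last by exists 0 => e [u ue]; rewrite -lee_fin -ue.
  by eexists; exists 0; rewrite /E energy_fin ?J0.
set m := inf S.
have m_le u : (m%:E <= E u)%E.
  case Eu : (E u) (E_ge0 u) => [e| |]// _; last by rewrite leey.
  by rewrite lee_fin; apply: ge_inf; [exact: S_inf.2 | exists u].
have /choice[u_ u_m] (k : nat) : exists u, (E u < (m + k.+1%:R^-1)%:E)%E.
  have [|e [u ue] em] := inf_adherent (eps := k.+1%:R^-1) _ S_inf.
    by rewrite invr_gt0.
  by exists u; rewrite ue lte_fin.
have Ju k : J (u_ k) \is a fin_num.
  apply: (@energy_fin_num _ _ _ A J alpha beta t f) => //.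
  by rewrite (lt_trans (u_m k))// ltry.
pose a k := `|A (u_ k) - f| `^ alpha.
pose b k := fine (J (u_ k)) `^ beta.
pose e k := alpha^-1 * a k + t / beta * b k.
have Ee k : E (u_ k) = (e k)%:E by rewrite /E energy_fin.
have me k : m <= e k by rewrite -lee_fin -Ee.
have e_lt k : e k < m + k.+1%:R^-1 by rewrite -lte_fin -Ee.
have a0 k : 0 <= a k by exact: powR_ge0.
have b0 k : 0 <= b k by exact: powR_ge0.
have ka : 0 < alpha^-1 by rewrite invr_gt0.
have kb : 0 < t / beta by rewrite divr_gt0.
have e_m1 k : e k <= m + 1.
  by rewrite (le_trans (ltW (e_lt k)))// lerD2l invf_le1 ?ltr0n// ler1n.
have aM k : a k <= alpha * (m + 1).
  rewrite -ler_pdivrMl//; apply: le_trans (e_m1 k).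
  by rewrite lerDl mulr_ge0// ltW.
have bM k : b k <= (t / beta)^-1 * (m + 1).
  rewrite ler_pdivlMl//; apply: le_trans (e_m1 k).
  by rewrite lerDr mulr_ge0// ltW.
have [C [D [C0 D0 CD]]] := coercive.
have uM k : `|u_ k| <= C * (1 + (t / beta)^-1 * (m + 1)) +
    D * (1 + alpha * (m + 1) + `|f|).
  apply: (le_trans (CD _ (Ju k))); apply: lerD; apply: ler_wpM2l => //.
    by apply: (le_trans (le_powR1D _ _ beta_ge1)); rewrite lerD2l; exact: bM.
  rewrite -[A _](subrK f) (le_trans (ler_normD _ _))// lerD2r.
  by apply: (le_trans (le_powR1D _ _ alpha_ge1)); rewrite lerD2l; exact: aM.
have e_cvg : e k @[k --> \oo] --> m.
  apply/cvgrPdist_lt => eps eps0; near=> k.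
  rewrite distrC ger0_norm ?subr_ge0// ltrBlDl (lt_trans (e_lt k))// ltrD2l.
  by near: k; exact: (near_infty_natSinv_lt (PosNum eps0)).
have [phi1 phi1_incr] : exists2 g : nat -> nat,
    increasing_seq g & cvgn (a \o g).
  apply: bolzano_weierstrass.
  exists (alpha * (m + 1)); split; first exact: num_real.
  move=> M mM k _ /=; rewrite ger0_norm// (le_trans (aM k))// ltW//.
move=> /cvg_ex[/= la a_phi1].
have phi1_ge n : (n <= phi1 n)%N.
  elim: n => // n /leq_ltn_trans; apply.
  by rewrite ltnNge; have := phi1_incr n.+1 n; rewrite leEnat => ->; rewrite ltnn.
have [phi2 [u [phi2_ge u_cvg]]] :=
  weak_star_sequentially_compact (u_ \o phi1) _ Y_separable (fun k => uM (phi1 k)).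
pose psi := phi1 \o phi2.
have psi_oo : psi n @[n --> \oo] --> \oo.
  by apply: cvg_infty_ge => n; exact: leq_trans (phi2_ge n) (phi1_ge _).
have a_cvg : a (psi k) @[k --> \oo] --> la.
  exact: (cvg_comp _ _ (cvg_infty_ge _ phi2_ge) a_phi1).
have e_psi : e (psi k) @[k --> \oo] --> m by exact: (cvg_comp _ _ psi_oo e_cvg).
pose lb := (t / beta)^-1 * (m - alpha^-1 * la).
have b_cvg : b (psi k) @[k --> \oo] --> lb.
  have -> : (fun k => b (psi k)) =
      (fun k => (t / beta)^-1 * (e (psi k) - alpha^-1 * a (psi k))).
    by apply/funext => k; rewrite /e addrAC subrr add0r mulKf// gt_eqF.
  by apply: cvgMr; apply: cvgB => //; apply: cvgMr.
exists u; split => // v _; apply: le_trans (m_le v).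
have -> : m = alpha^-1 * la + t / beta * lb.
  by rewrite /lb mulVKf ?gt_eqF// addrC subrK.
rewrite /E /energy EFinD; apply: leeD.
  rewrite lee_fin ler_pM2l// -lee_fin -poweR_EFin.
  apply: poweR_le_cvg a_cvg => //.
  move=> c; rewrite lte_fin; apply: weak_cvg_norm_lsc.
  exact/weak_cvgB_cst/A_weak.
rewrite [leRHS]EFinM lee_pmul2l//; apply: poweR_le_cvg b_cvg => // c /J_lsc[V uV Vc].
have uV_near : \forall k \near \oo, V (u_ (psi k)) := u_cvg _ uV.
apply: filterS uV_near => k /Vc.
by rewrite -[X in (_ < X)%E](fineK (Ju _)) lte_fin.
Unshelve. all: by end_near. Qed.

(** * Uniqueness of the image of a minimizer *)

(** At the midpoint [w] of two minimizers, [ca], [rb], [ha] and [hb] bound the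
    energy by the mean of the two minimal values; strictness in any of them
    would contradict minimality.  In the following, [a], [b], [c] are the
    residuals and [p], [q], [r] the values of [J] at [u], [v], [w]. *)
Lemma energy_argmin_unique {R : realType} {W : normedModType R}
  {H : hilbertType R} (A : {linear W -> H}) (J : W -> \bar R)
  (J_ge0 : forall u, (0 <= J u)%E) (J_convex : econvex J)
  (J_dom : exists u, J u \is a fin_num)
  (f : H) (alpha beta t : R) (alpha_ge1 : 1 <= alpha) (beta_ge1 : 1 <= beta)
  (alpha_beta_gt1 : 1 < alpha \/ 1 < beta) (t_gt0 : 0 < t) u v :
  argmin_on setT (energy A J alpha beta t f) u ->
  argmin_on setT (energy A J alpha beta t f) v -> A u = A v.
Proof.
move=> [_ umin] [_ vmin].
have alpha_gt0 : 0 < alpha by exact: lt_le_trans alpha_ge1.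
have beta_gt0 : 0 < beta by exact: lt_le_trans beta_ge1.
have [z Jz] := J_dom.
have Ju : J u \is a fin_num.
  apply: (@energy_fin_num _ _ _ A J alpha beta t f) => //.
  by apply: le_lt_trans (umin z I) _; rewrite energy_fin// ltry.
have Jv : J v \is a fin_num.
  apply: (@energy_fin_num _ _ _ A J alpha beta t f) => //.
  by apply: le_lt_trans (vmin z I) _; rewrite energy_fin// ltry.
set w := 2^-1 *: (u + v).
have Jw_le : (J w <= (2^-1 * (fine (J u) + fine (J v)))%:E)%E.
  have half01 : 0 <= (2^-1 : R) <= 1 by apply/andP; split; lra.
  have := J_convex 2^-1 u v half01.
  have -> : 1 - 2^-1 = 2^-1 :> R by lra.
  rewrite -scalerDr -/w => /le_trans; apply.
  by rewrite -[in leLHS](fineK Ju) -[in leLHS](fineK Jv) -!EFinM -EFinD lee_fin mulrDr.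
have Jw : J w \is a fin_num.
  by rewrite ge0_fin_numE// (le_lt_trans Jw_le)// ltry.
have := umin w I; have := vmin w I; have := umin v I; have := vmin u I.
rewrite !energy_fin// !lee_fin.
move: Jw_le; rewrite -(fineK Jw) lee_fin.
have [p0 q0 r0] : [/\ 0 <= fine (J u), 0 <= fine (J v) & 0 <= fine (J w)].
  by split; exact: fine_ge0.
move: p0 q0 r0.
set p := fine (J u); set q := fine (J v); set r := fine (J w) => p0 q0 r0 rpq.
have Aw : A w - f = 2^-1 *: ((A u - f) + (A v - f)).
  rewrite /w linearZ /= linearD addrACA -opprD scalerBr; congr (_ - _).
  by rewrite -[f in f + f]scale1r -scalerDl scalerA (_ : 2^-1 * _ = 1) ?scale1r//; lra.
set a := `|A u - f|; set b := `|A v - f|; set c := `|A w - f|.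
have [a0 b0 c0] : [/\ 0 <= a, 0 <= b & 0 <= c] by split; exact: normr_ge0.
have cab : c <= 2^-1 * (a + b).
  rewrite /c Aw normrZ ger0_norm ?invr_ge0//.
  by rewrite ler_pM2l ?invr_gt0// ler_normD.
move=> E1 E2 E3 E4.
have ka : 0 < alpha^-1 by rewrite invr_gt0.
have kb : 0 < t / beta by rewrite divr_gt0.
have ca : c `^ alpha <= (2^-1 * (a + b)) `^ alpha.
  by rewrite ge0_ler_powR ?nnegrE// ?(ltW alpha_gt0)// mulr_ge0// addr_ge0.
have rb : r `^ beta <= (2^-1 * (p + q)) `^ beta.
  by rewrite ge0_ler_powR ?nnegrE// ?(ltW beta_gt0)// mulr_ge0// addr_ge0.
have ha := powR_midpoint_le alpha a b alpha_ge1 a0 b0.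
have hb := powR_midpoint_le beta p q beta_ge1 p0 q0.
(* A strict convexity gap in either power would make [w] better than both [u]
   and [v]. *)
have ab : a = b.
  case: alpha_beta_gt1 => [alpha_gt1|beta_gt1].
    apply/eqP/negPn/negP => ab.
    have := powR_midpoint_lt alpha a b alpha_gt1 a0 b0 ab => ha'.
    have ca' : c `^ alpha < 2^-1 * (a `^ alpha + b `^ alpha) by lra.
    have rb' : r `^ beta <= 2^-1 * (p `^ beta + q `^ beta) by lra.
    move: ca' rb'; rewrite -(ltr_pM2l ka) -(ler_pM2l kb); lra.
  have pq : p = q.
    apply/eqP/negPn/negP => pq.
    have := powR_midpoint_lt beta p q beta_gt1 p0 q0 pq => hb'.
    have ca' : c `^ alpha <= 2^-1 * (a `^ alpha + b `^ alpha) by lra.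
    have rb' : r `^ beta < 2^-1 * (p `^ beta + q `^ beta) by lra.
    move: ca' rb'; rewrite -(ler_pM2l ka) -(ltr_pM2l kb); lra.
  have : a `^ alpha = b `^ alpha.
    move: E1 E2; rewrite pq !lerD2r !ler_pM2l// => h1 h2.
    by apply/eqP; rewrite eq_le h1 h2.
  by apply: (powR_injective alpha_gt0); rewrite nnegrE.
apply/eqP/negPn/negP => Auv.
have clt : c < a.
  rewrite /c Aw; apply: norm_midpoint_lt; first exact: ab.
  by apply: contra Auv => /eqP /addIr ->.
have ca' : c `^ alpha < a `^ alpha by rewrite gt0_ltr_powR ?nnegrE.
have rb' : r `^ beta <= 2^-1 * (p `^ beta + q `^ beta) by lra.
move: ca' rb'; rewrite -(ltr_pM2l ka) -(ler_pM2l kb).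
move: E1 E2 E3 E4; rewrite -ab; lra.
Qed.

Theorem theorem2p16 (R : realType) (Y : completeNormedModType R)
  (Y_separable : separable Y) (H : hilbertType R)
  (A : {linear dual Y -> H}) (A_bounded : bounded_near A (nbhs (0 : dual Y)))
  (J : dual Y -> \bar R)
  (J_ge0 : forall u, (0 <= J u)%E)
  (J_convex : econvex J)
  (J_proper : exists u, (J u < +oo)%E)
  (J_lsc : lower_semicontinuous (J : weak_star Y -> \bar R))
  (J_homogeneous : abs_one_homogeneous J)
  (f : H) (f_datum : forall u, A u = f -> J u <> 0%E)
  (A_norm : norm_on (nullspace J) (fun u => `|A u|))
  (A_norm_equiv :
    equivalent_on (nullspace J) (fun u => `|A u|) (fun u => `|u|))
  (J_poincare : exists2 C : R, 0 < C &
    forall u, (`|u - null_proj A J (A u)|%:E <= C%:E * J u)%E)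
  (A_weak : forall (u_ : nat -> dual Y) (u : dual Y),
    weak_star_cvg u_ u -> weak_cvg (fun k => A (u_ k)) (A u))
  (alpha beta : R) (alpha_ge1 : 1 <= alpha) (beta_ge1 : 1 <= beta)
  (alpha_beta_gt1 : 1 < alpha \/ 1 < beta)
  (t : R) (t_gt0 : 0 < t) :
  exists h : H, [set A u | u in argmin_on setT (energy A J alpha beta t f)]
                = [set h].
Proof.
have J0 : J 0 = 0%E.
  by have := J_homogeneous 0 0; rewrite scale0r normr0 mul0e.
have [C C0 J_le] := J_poincare.
have [D D0 CD] := norm_coercive A J C (ltW C0) J0 J_ge0 A_norm_equiv J_le.
have coercive : exists C D : R, [/\ 0 <= C, 0 <= D & forall u,
    J u \is a fin_num -> `|u| <= C * fine (J u) + D * `|A u|].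
  by exists C, D; split => //; exact: ltW.
have [u u_min] := energy_argmin_exists Y_separable A J J_ge0 J0 J_lsc coercive
  A_weak f alpha beta t alpha_ge1 beta_ge1 t_gt0.
exists (A u); apply/seteqP; split => [_ [v v_min <-]|_ ->]; last by exists u.
apply: (energy_argmin_unique A J J_ge0 J_convex _ f alpha beta t alpha_ge1
  beta_ge1 alpha_beta_gt1 t_gt0) v_min u_min.
by exists 0; rewrite J0.
Qed.
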